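(* Disjoint union is a product in the category of groupoids with Zakrzewski morphisms. That is, let $\Gamma=\Gamma_1\cup\Gamma_2$ be the disjoint union of groupoids $\Gamma_1,\Gamma_2$, with inclusion maps $i_k:\Gamma_k\to\Gamma$, and let $i_k^T$ be the transposed relations, which are morphisms from $\Gamma$ to $\Gamma_k$ ($k=1,2$). Then for every groupoid $K$ and all morphisms $h_1$ from $K$ to $\Gamma_1$ and $h_2$ from $K$ to $\Gamma_2$ there exists a unique morphism $h$ from $K$ to $\Gamma$ such that $i_1^Th=h_1$ and $i_2^Th=h_2$.
   Context: A relation $r$ from a set $X$ to a set $Y$ is given by its graph, a subset of $Y\times X$; we write $(y,x)\in r$. For $A\subset X$, $r(A)=\{y:\exists x\in A,\ (y,x)\in r\}$. The transposition $r^T$ is the relation from $Y$ to $X$ with $(x,y)\in r^T\iff(y,x)\in r$; a map is identified with the relation given by its graph. Relations are composed by $(z,x)\in tr\iff\exists y:\ (z,y)\in t,\ (y,x)\in r$, and $r\times r_1=\{(y,y_1;x,x_1):(y,x)\in r,\ (y_1,x_1)\in r_1\}$. A groupoid $\Gamma\rightrightarrows E$ is a small category with all morphisms invertible; $\Gamma$ is the set of morphisms and $E=\Gamma^{(0)}\subset\Gamma$ the set of identities. $s(\gamma)$ is the inverse of $\gamma$. The multiplication is the relation $m$ from $\Gamma\times\Gamma$ to $\Gamma$ with $(\gamma;\gamma_1,\gamma_2)\in m$ iff $\gamma_1\gamma_2$ is defined and equals $\gamma$. A (Zakrzewski) morphism from $\Gamma\rightrightarrows E$ to $\Gamma_1\rightrightarrows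 E_1$ is a relation $h$ from $\Gamma$ to $\Gamma_1$ such that $hm=m_1(h\times h)$, $hs=s_1h$ and $h(E)=E_1$ (here $m_1,s_1$ are the structure relations of $\Gamma_1$). Groupoids with these morphisms form a category under composition of relations. *)

(* Defs.v *)
From mathcomp Require Import all_boot.
From mathcomp Require Import boolp classical_sets.

Set Implicit Arguments.
Unset Strict Implicit.
Unset Printing Implicit Defensive.

Local Open Scope classical_set_scope.
Local Open Scope relation_scope.

(* A relation from X to Y is its graph, a subset of Y * X: the target comes
   first. *)
Definition rel_from_to (X Y : Type) := set (Y * X).

Definition rel_graph (X Y : Type) (f : X -> Y) : rel_from_to X Y :=
  [set p | p.1 = f p.2].

Definition rel_transpose (X Y : Type) (r : rel_from_to X Y) : rel_from_to Y X :=
  r^-1.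

(* "t after r"; the notation [\;] of [classical_sets] is in diagrammatic order
   once pairs are read target first. *)
Definition rel_comp (X Y Z : Type)
    (t : rel_from_to Y Z) (r : rel_from_to X Y) : rel_from_to X Z :=
  r \; t.

Definition rel_image (X Y : Type) (r : rel_from_to X Y) (A : set X) : set Y :=
  [set y | exists2 x, A x & r (y, x)].

Definition rel_prod (X Y X1 Y1 : Type)
    (r : rel_from_to X Y) (r1 : rel_from_to X1 Y1) :
    rel_from_to (X * X1) (Y * Y1) :=
  [set p | r (p.1.1, p.2.1) /\ r1 (p.1.2, p.2.2)].

(* A small category with all morphisms invertible, in its arrows-only form:
   objects are identified with their identities. [gsrc g] and [gtgt g] are the
   identities at the source and at the target of g, and [gmul f g] is
   [Some (f g)] if f g is defined (i.e. [gsrc f = gtgt g]), [None] otherwise. *)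
Record groupoid : Type := Groupoid {
  arrow :> Type;
  gsrc : arrow -> arrow;
  gtgt : arrow -> arrow;
  gmul : arrow -> arrow -> option arrow;
  ginv : arrow -> arrow;
  gsrc_tgt : forall g, gsrc (gtgt g) = gtgt g;
  gtgt_src : forall g, gtgt (gsrc g) = gsrc g;
  gmul_def : forall f g, gmul f g <-> gsrc f = gtgt g;
  gsrc_mul : forall f g k, gmul f g = Some k -> gsrc k = gsrc g;
  gtgt_mul : forall f g k, gmul f g = Some k -> gtgt k = gtgt f;
  gmul1 : forall g, gmul g (gsrc g) = Some g;
  gmul1l : forall g, gmul (gtgt g) g = Some g;
  gmulA : forall f g k u v,
    gmul f g = Some u -> gmul g k = Some v -> gmul u k = gmul f v;
  gmulVg : forall g, gmul (ginv g) g = Some (gsrc g);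
  gmulgV : forall g, gmul g (ginv g) = Some (gtgt g)
}.

Definition units (G : groupoid) : set G := [set e | gsrc e = e].

Definition mult_rel (G : groupoid) : rel_from_to (G * G) G :=
  [set p | gmul p.2.1 p.2.2 = Some p.1].

Definition inv_rel (G : groupoid) : rel_from_to G G := rel_graph (@ginv G).

Arguments mult_rel : clear implicits.
Arguments inv_rel : clear implicits.
Arguments units : clear implicits.

Definition zakrzewski_morphism (G G1 : groupoid) (h : rel_from_to G G1) : Prop :=
  [/\ rel_comp h (mult_rel G) = rel_comp (mult_rel G1) (rel_prod h h),
      rel_comp h (inv_rel G) = rel_comp (inv_rel G1) h
    & rel_image h (units G) = units G1].

Section DisjointUnion.
Variables G1 G2 : groupoid.

Let U : Type := (G1 + G2)%type.

Definition du_src (x : U) : U :=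
  match x with inl a => inl (gsrc a) | inr b => inr (gsrc b) end.

Definition du_tgt (x : U) : U :=
  match x with inl a => inl (gtgt a) | inr b => inr (gtgt b) end.

Definition du_inv (x : U) : U :=
  match x with inl a => inl (ginv a) | inr b => inr (ginv b) end.

Definition du_mul (x y : U) : option U :=
  match x, y with
  | inl a, inl a' => omap inl (gmul a a')
  | inr b, inr b' => omap inr (gmul b b')
  | _, _ => None
  end.

Lemma du_src_tgt x : du_src (du_tgt x) = du_tgt x.
Proof. by case: x => a /=; rewrite gsrc_tgt. Qed.

Lemma du_tgt_src x : du_tgt (du_src x) = du_src x.
Proof. by case: x => a /=; rewrite gtgt_src. Qed.

Lemma du_mul_def x y : du_mul x y <-> du_src x = du_tgt y.
Proof.
case: x y => [a|b] [a'|b'] //=.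
- have := gmul_def a a'; case: (gmul a a') => [k|] /= [H1 H2]; split=> //.
  + by move=> _; rewrite H1.
  + by case.
- have := gmul_def b b'; case: (gmul b b') => [k|] /= [H1 H2]; split=> //.
  + by move=> _; rewrite H1.
  + by case.
Qed.

Lemma du_src_mul x y z : du_mul x y = Some z -> du_src z = du_src y.
Proof.
case: x y => [a|b] [a'|b'] //=.
- by case E: (gmul a a') => [k|] //= [<-] /=; rewrite (gsrc_mul E).
- by case E: (gmul b b') => [k|] //= [<-] /=; rewrite (gsrc_mul E).
Qed.

Lemma du_tgt_mul x y z : du_mul x y = Some z -> du_tgt z = du_tgt x.
Proof.
case: x y => [a|b] [a'|b'] //=.
- by case E: (gmul a a') => [k|] //= [<-] /=; rewrite (gtgt_mul E).
- by case E: (gmul b b') => [k|] //= [<-] /=; rewrite (gtgt_mul E).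
Qed.

Lemma du_mul1 x : du_mul x (du_src x) = Some x.
Proof. by case: x => a /=; rewrite gmul1. Qed.

Lemma du_mul1l x : du_mul (du_tgt x) x = Some x.
Proof. by case: x => a /=; rewrite gmul1l. Qed.

Lemma du_mulA x y z u v :
  du_mul x y = Some u -> du_mul y z = Some v -> du_mul u z = du_mul x v.
Proof.
case: x y z => [a|b] [a'|b'] [a''|b''] //=.
- case E: (gmul a a') => [k|] //= [<-]; case F: (gmul a' a'') => [l|] //= [<-].
  by rewrite /= (gmulA E F).
- case E: (gmul b b') => [k|] //= [<-]; case F: (gmul b' b'') => [l|] //= [<-].
  by rewrite /= (gmulA E F).
Qed.

Lemma du_mulVx x : du_mul (du_inv x) x = Some (du_src x).
Proof. by case: x => a /=; rewrite gmulVg. Qed.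

Lemma du_mulxV x : du_mul x (du_inv x) = Some (du_tgt x).
Proof. by case: x => a /=; rewrite gmulgV. Qed.

Definition disjoint_union : groupoid :=
  Groupoid du_src_tgt du_tgt_src du_mul_def du_src_mul du_tgt_mul
    du_mul1 du_mul1l du_mulA du_mulVx du_mulxV.

Definition du_incl1 : G1 -> disjoint_union := inl.

Definition du_incl2 : G2 -> disjoint_union := inr.

End DisjointUnion.

(* Main.v *)
Require Import Defs.
From mathcomp Require Import all_boot.
From mathcomp Require Import boolp classical_sets.

(** Composing a relation [h] into the disjoint union with the transpose of an
    inclusion restricts [h] to the pairs whose target lies in that component
    ([rel_comp_transpose_graph]).  Since every arrow of the union lies in
    exactly one component, [h] is determined by its two restrictions, and any
    two relations [h1], [h2] are the restrictions of their union [rel_pair].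
    This gives uniqueness of [h], and existence as a mere relation.

    That the union of two morphisms is a morphism holds because the product,
    the inverse and the units of a disjoint union are those of its components,
    and arrows of different components are never composable.  Each of the three
    identities defining a morphism therefore splits, according to the component
    of the target arrow, into the same identity for [h1] and for [h2].  The same
    splitting shows that the transposed inclusions are morphisms. *)

Local Open Scope classical_set_scope.

(** The pointwise form makes it possible to split the three conditions
    according to the component in which the target [a] lies. *)
Lemma zakrzewski_morphismP (G H : groupoid) (h : rel_from_to G H) :
  zakrzewski_morphism h <->
  [/\ forall (a : H) (k l : G),
        (exists2 c, h (a, c) & gmul k l = Some c) <->
        (exists a1 a2, [/\ gmul a1 a2 = Some a, h (a1, k) & h (a2, l)]),
      forall (a : H) (k : G),
        h (a, ginv k) <-> (exists2 b, a = ginv b & h (b, k))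
    & forall a : H, (exists2 e, gsrc e = e & h (a, e)) <-> gsrc a = a].
Proof.
split=> [[hm hs hE]|[hm hs hE]]; split.
- move=> a k l; split=> [ex|[a1 [a2 [ma h1 h2]]]].
    have : rel_comp h (mult_rel G) (a, (k, l)) by [].
    by rewrite hm => -[[a1 a2] /= ma [h1 h2]]; exists a1, a2.
  have : rel_comp (mult_rel H) (rel_prod h h) (a, (k, l)) by exists (a1, a2).
  by rewrite -hm.
- move=> a k; split=> [hak|[b ab hbk]].
    have : rel_comp h (inv_rel G) (a, k) by exists (ginv k).
    by rewrite hs => -[b]; exists b.
  have : rel_comp (inv_rel H) h (a, k) by exists b.
  by rewrite -hs => -[c /= hac ck]; rewrite -[ginv k]ck.
- by move=> a; rewrite -[gsrc a = a]/(units H a) -hE.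
- apply/seteqP; split=> -[a [k l]] /=.
    by move/(hm a k l) => -[a1 [a2 [ma h1 h2]]]; exists (a1, a2).
  by move=> -[[a1 a2] /= ma [h1 h2]]; apply/(hm a k l); exists a1, a2.
- apply/seteqP; split=> -[a k] /=.
    by move=> -[c /= hac ck]; apply/hs; rewrite -[ginv k]ck.
  by move/(hs a k) => hak; exists (ginv k).
- by apply/seteqP; split=> a /hE.
Qed.

Lemma rel_transpose_graphE (X Y : Type) (f : X -> Y) :
  rel_transpose (rel_graph f) = [set p | p.2 = f p.1].
Proof. by []. Qed.

Lemma rel_comp_transpose_graph (K X Y : Type) (f : X -> Y)
    (h : rel_from_to K Y) :
  rel_comp (rel_transpose (rel_graph f)) h = [set p | h (f p.1, p.2)].
Proof.
rewrite rel_transpose_graphE; apply/seteqP; split=> -[x k] /=; first by move=> -[y /= ->].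
by exists (f x).
Qed.

Definition rel_pair (K X Y : Type) (h1 : rel_from_to K X)
    (h2 : rel_from_to K Y) : rel_from_to K (X + Y) :=
  [set p | match p.1 with inl a => h1 (a, p.2) | inr b => h2 (b, p.2) end].

Arguments rel_pair {K X Y}.

Lemma du_mul_inl (G1 G2 : groupoid) (x y : G1 + G2) (a : G1) :
  du_mul x y = Some (inl a) ->
  exists a1 a2, [/\ x = inl a1, y = inl a2 & gmul a1 a2 = Some a].
Proof.
case: x y => [a1|b1] [a2|b2] //=; last by case: gmul.
by case E: gmul => [c|] //= [<-]; exists a1, a2.
Qed.

Lemma du_mul_inr (G1 G2 : groupoid) (x y : G1 + G2) (b : G2) :
  du_mul x y = Some (inr b) ->
  exists b1 b2, [/\ x = inr b1, y = inr b2 & gmul b1 b2 = Some b].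
Proof.
case: x y => [a1|b1] [a2|b2] //=; first by case: gmul.
by case E: gmul => [c|] //= [<-]; exists b1, b2.
Qed.

(** The transposed inclusion is the identity on its own component and empty on
    the other.  It preserves products because a product lying in a component has
    both factors there, and it is onto the units because each unit of the
    component is the image of itself. *)
Lemma transpose_incl1_morphism (G1 G2 : groupoid) :
  @zakrzewski_morphism (disjoint_union G1 G2) G1
    (rel_transpose (rel_graph (@du_incl1 G1 G2))).
Proof.
rewrite rel_transpose_graphE.
apply/zakrzewski_morphismP; split=> [a x y|a x|a]; split.
- move=> -[_ /= -> /du_mul_inl[a1 [a2 [-> -> ma]]]].
  by exists a1, a2.
- by move=> -[a1 [a2 [ma /= -> ->]]]; exists (inl a); rewrite //= ma.
- by case: x => [c|d] //= [<-]; exists c.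
- by move=> -[c -> /= ->].
- by move=> -[e /= + ea]; rewrite ea => -[].
- by move=> ea; exists (inl a) => //=; rewrite ea.
Qed.

Lemma transpose_incl2_morphism (G1 G2 : groupoid) :
  @zakrzewski_morphism (disjoint_union G1 G2) G2
    (rel_transpose (rel_graph (@du_incl2 G1 G2))).
Proof.
rewrite rel_transpose_graphE.
apply/zakrzewski_morphismP; split=> [b x y|b x|b]; split.
- move=> -[_ /= -> /du_mul_inr[b1 [b2 [-> -> mb]]]].
  by exists b1, b2.
- by move=> -[b1 [b2 [mb /= -> ->]]]; exists (inr b); rewrite //= mb.
- by case: x => [c|d] //= [<-]; exists d.
- by move=> -[d -> /= ->].
- by move=> -[e /= + eb]; rewrite eb => -[].
- by move=> eb; exists (inr b) => //=; rewrite eb.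
Qed.

(** A factorization of an arrow of one component has both factors in that
    component, so at each target only one of [h1] and [h2] is involved. *)
Lemma rel_pair_morphism (K G1 G2 : groupoid)
    (h1 : rel_from_to K G1) (h2 : rel_from_to K G2) :
  zakrzewski_morphism h1 -> zakrzewski_morphism h2 ->
  @zakrzewski_morphism K (disjoint_union G1 G2) (rel_pair h1 h2).
Proof.
move=> /zakrzewski_morphismP[m1 s1 e1] /zakrzewski_morphismP[m2 s2 e2].
apply/zakrzewski_morphismP; split=> [[a|b] k l|[a|b] k|[a|b]].
- split=> [/(m1 a k l)[a1 [a2 [ma hk hl]]]|].
    exists (inl a1), (inl a2); split=> //=; by rewrite ma.
  move=> -[_ [_ [/du_mul_inl[a1 [a2 [-> -> ma]]] hk hl]]].
  by apply/(m1 a k l); exists a1, a2.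
- split=> [/(m2 b k l)[b1 [b2 [mb hk hl]]]|].
    exists (inr b1), (inr b2); split=> //=; by rewrite mb.
  move=> -[_ [_ [/du_mul_inr[b1 [b2 [-> -> mb]]] hk hl]]].
  by apply/(m2 b k l); exists b1, b2.
- split=> [/(s1 a k)[c -> hc]|]; first by exists (inl c).
  by move=> -[[c|d] //= [->] hc]; apply/(s1 _ k); exists c.
- split=> [/(s2 b k)[d -> hd]|]; first by exists (inr d).
  by move=> -[[c|d] //= [->] hd]; apply/(s2 _ k); exists d.
- by split=> [/(e1 a) /= ->|[/(e1 a)]].
- by split=> [/(e2 b) /= ->|[/(e2 b)]].
Qed.

Theorem proposition3p17 (G1 G2 : groupoid) :
  let i1 := rel_graph (@du_incl1 G1 G2) in
  let i2 := rel_graph (@du_incl2 G1 G2) in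
  [/\ @zakrzewski_morphism (disjoint_union G1 G2) G1 (rel_transpose i1),
      @zakrzewski_morphism (disjoint_union G1 G2) G2 (rel_transpose i2)
    & forall (K : groupoid) (h1 : rel_from_to K G1) (h2 : rel_from_to K G2),
        zakrzewski_morphism h1 -> zakrzewski_morphism h2 ->
        exists! h : rel_from_to K (disjoint_union G1 G2),
          [/\ zakrzewski_morphism h,
              rel_comp (rel_transpose i1) h = h1
            & rel_comp (rel_transpose i2) h = h2]].
Proof.
split; [exact: transpose_incl1_morphism|exact: transpose_incl2_morphism|].
move=> K h1 h2 mor1 mor2; exists (rel_pair h1 h2); split.
  split; first exact: rel_pair_morphism.
  - by rewrite rel_comp_transpose_graph; apply/seteqP; split=> -[].
  - by rewrite rel_comp_transpose_graph; apply/seteqP; split=> -[].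
move=> h [_]; rewrite !rel_comp_transpose_graph => <- <-.
by apply/seteqP; split=> -[[a|b] k].
Qed.
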